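(* For any symmetric convex bodies $P,Q \subseteq \mathbb{R}^m$ and any $k \in \mathbb{N}$ one has \[ \mathrm{ac}_k(P,Q) \leq 4\sum_{\ell \geq 1} \frac{1}{k2^{\ell}} \cdot \mathrm{vb}_{k2^{\ell}}(P,Q). \] Moreover, given $X \subseteq P$ and $\boldsymbol{z} \in \mathrm{conv}(X)$, where $\boldsymbol{z}$ is given as a convex combination of at most $m+1$ vectors from $X$, vectors $\boldsymbol{v}_1,\ldots,\boldsymbol{v}_k \in X$ (repetition allowed) for which $\|\boldsymbol{z}-\frac1k\sum_{i=1}^k \boldsymbol{v}_i\|_Q$ is at most the right-hand side can be found in time $O(\log m)$ times the time to find a coloring behind $\mathrm{vb}_t(P,Q)$ where $t \leq m+1$.
   Context: A symmetric convex body $K\subseteq\mathbb{R}^m$ is a compact convex set with nonempty interior and $K=-K$; its norm is $\|\boldsymbol{x}\|_K = \min\{ s \geq 0 \mid \boldsymbol{x} \in sK\}$. For symmetric convex bodies $P,Q\subseteq \mathbb{R}^m$ and $k\in\mathbb{N}=\{1,2,\dots\}$, \[ \mathrm{ac}_k(P,Q) := \sup_{X \subseteq P,\ \boldsymbol{z} \in \mathrm{conv}(X)}\ \inf_{\boldsymbol{v}_1,\ldots,\boldsymbol{v}_k \in X} \Big\|\boldsymbol{z}-\frac{1}{k}\sum_{i=1}^k \boldsymbol{v}_i\Big\|_Q , \] where the $\boldsymbol{v}_i$ may be taken with repetition. For $n\in\mathbb{N}$, \[ \mathrm{vb}_{n}(P,Q) := \sup\Big\{ \min_{\boldsymbol{x}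 \in \{ -1,1\}^n} \Big\| \sum_{i=1}^n x_i\boldsymbol{v}_i \Big\|_Q \ \Big|\ \boldsymbol{v}_1,\ldots,\boldsymbol{v}_n \in P \Big\}. \] ''The time to find a coloring behind $\mathrm{vb}_t(P,Q)$'' is the time needed, given $\boldsymbol{v}_1,\ldots,\boldsymbol{v}_t\in P$, to find $\boldsymbol{x}\in\{-1,1\}^t$ with $\|\sum_{i=1}^t x_i\boldsymbol{v}_i\|_Q\le \mathrm{vb}_t(P,Q)$. *)

(* Defs.v *)
(* MathComp-Analysis development. *)
From mathcomp Require Export all_boot all_order all_algebra.
From mathcomp Require Export all_classical all_reals all_analysis.
Export numFieldNormedType.Exports.

Set Implicit Arguments.
Unset Strict Implicit.
Unset Printing Implicit Defensive.

Import Order.TTheory GRing.Theory Num.Theory.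
Local Open Scope classical_set_scope.
Local Open Scope ring_scope.

Section Bodies.
Context {R : realType} {m : nat}.
Local Notation V := 'rV[R]_m.

Definition symmetric_convex_body (K : set V) : Prop :=
  [/\ compact K, convex_set K, K° !=set0 & K = [set - x | x in K]].

(* For a symmetric convex body K the set of admissible s is nonempty, closed
   and bounded below, so the infimum is the minimum. *)
Definition body_norm (K : set V) (x : V) : R :=
  inf [set s | 0 <= s /\ [set s *: y | y in K] x].

Definition convex_hull (X : set V) : set V :=
  [set z | exists n (u : 'I_n -> V) (lam : 'I_n -> R),
    [/\ forall i, X (u i), forall i, 0 <= lam i, \sum_i lam i = 1
      & z = \sum_i lam i *: u i]].

(* [ac] and [vb] are extended reals, so that no boundedness is presupposed. *)
Definition ac (k : nat) (P Q : set V) : \bar R :=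
  ereal_sup [set e | exists (X : set V) (z : V),
    [/\ X `<=` P, convex_hull X z
      & e = ereal_inf [set d | exists v : 'I_k -> V, (forall i, X (v i)) /\
            d = (body_norm Q (z - k%:R^-1 *: \sum_i v i))%:E]]].

(* A coloring x in {-1,1}^n is given by booleans; b stands for (-1)^b. *)
Definition signed_sum n (v : 'I_n -> V) (x : {ffun 'I_n -> bool}) : V :=
  \sum_i (-1) ^+ x i *: v i.

Definition vb (n : nat) (P Q : set V) : \bar R :=
  ereal_sup [set e | exists v : 'I_n -> V, (forall i, P (v i)) /\
    e = \big[Order.min/+oo%E]_(x : {ffun 'I_n -> bool})
          (body_norm Q (signed_sum v x))%:E].

Definition ac_bound (k : nat) (P Q : set V) : \bar R :=
  (4%:E * \sum_(1 <= l <oo)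
            ((k * 2 ^ l)%N%:R^-1)%:E * vb (k * 2 ^ l)%N P Q)%E.

(* [T t] bounds the time that the procedure [col] needs on t vectors. It is at
   least the input length m * t. Nothing is assumed about [col] or [T] outside
   1 <= t <= N, nor about [col] on vectors outside P. *)
Definition coloring_procedure (P Q : set V) (N : nat)
    (col : forall t, ('I_t -> V) -> {ffun 'I_t -> bool}) (T : nat -> nat) :=
  forall t, (1 <= t <= N)%N -> (m * t <= T t)%N /\
    forall v : 'I_t -> V, (forall i, P (v i)) ->
      ((body_norm Q (signed_sum v (col t v)))%:E <= vb t P Q)%E.

End Bodies.

(* Real RAM, presented as a while language over index registers (naturals),
   arrays of reals and arrays of vectors of R^m. Programs are first-order
   syntax, independent of the dimension m and of the inputs, and can reach P
   and Q only through [Color]. Each scalar operation, including the floor,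
   takes one step; each vector operation takes m steps. *)

Inductive iexp :=
| INat of nat
| IReg of nat
| IAdd of iexp & iexp
| ISub of iexp & iexp.

Inductive rexp :=
| RNat of nat
| RIdx of iexp
| RCell of nat & iexp
| RAdd of rexp & rexp
| RSub of rexp & rexp
| RMul of rexp & rexp
| RDiv of rexp & rexp
| RFloor of rexp.

Inductive vexp :=
| VCell of nat & iexp
| VAdd of vexp & vexp
| VSub of vexp & vexp
| VScale of rexp & vexp.

Inductive test :=
| ILt of iexp & iexp
| RLt of rexp & rexp
| TNot of test
| TAnd of test & test.

(* [Color a e x]: call the coloring procedure on the first e cells of the
   vector array a and store the e signs in the real array x. *)
Inductive cmd :=
| Skip
| SetI of nat & iexp
| SetR of nat & iexp & rexp
| SetV of nat & iexp & vexp
| Color of nat & iexp & nat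
| Seq of cmd & cmd
| If of test & cmd & cmd
| While of test & cmd.

Record state (R : realType) (m : nat) := State {
  ireg : nat -> nat;
  rmem : nat -> nat -> R;
  vmem : nat -> nat -> 'rV[R]_m }.

Section Machine.
Context {R : realType} {m : nat}.
Local Notation V := 'rV[R]_m.
Local Notation state := (state R m).

Fixpoint ieval (s : state) (e : iexp) : nat :=
  match e with
  | INat c => c
  | IReg r => ireg s r
  | IAdd e1 e2 => (ieval s e1 + ieval s e2)%N
  | ISub e1 e2 => (ieval s e1 - ieval s e2)%N
  end.

Fixpoint reval (s : state) (e : rexp) : R :=
  match e with
  | RNat c => c%:R
  | RIdx i => (ieval s i)%:R
  | RCell a i => rmem s a (ieval s i)
  | RAdd e1 e2 => reval s e1 + reval s e2
  | RSub e1 e2 => reval s e1 - reval s e2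
  | RMul e1 e2 => reval s e1 * reval s e2
  | RDiv e1 e2 => reval s e1 / reval s e2
  | RFloor e1 => (Num.floor (reval s e1))%:~R
  end.

Fixpoint veval (s : state) (e : vexp) : V :=
  match e with
  | VCell a i => vmem s a (ieval s i)
  | VAdd e1 e2 => veval s e1 + veval s e2
  | VSub e1 e2 => veval s e1 - veval s e2
  | VScale c e1 => reval s c *: veval s e1
  end.

Fixpoint teval (s : state) (b : test) : bool :=
  match b with
  | ILt e1 e2 => (ieval s e1 < ieval s e2)%N
  | RLt e1 e2 => reval s e1 < reval s e2
  | TNot b1 => ~~ teval s b1
  | TAnd b1 b2 => teval s b1 && teval s b2
  end.

Fixpoint icost (e : iexp) : nat :=
  match e with
  | INat _ | IReg _ => 1
  | IAdd e1 e2 | ISub e1 e2 => (icost e1 + icost e2).+1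
  end.

Fixpoint rcost (e : rexp) : nat :=
  match e with
  | RNat _ => 1
  | RIdx i | RCell _ i => (icost i).+1
  | RAdd e1 e2 | RSub e1 e2 | RMul e1 e2 | RDiv e1 e2 =>
      (rcost e1 + rcost e2).+1
  | RFloor e1 => (rcost e1).+1
  end.

Fixpoint vcost (e : vexp) : nat :=
  match e with
  | VCell _ i => (icost i + m)%N
  | VAdd e1 e2 | VSub e1 e2 => (vcost e1 + vcost e2 + m)%N
  | VScale c e1 => (rcost c + vcost e1 + m)%N
  end.

Fixpoint tcost (b : test) : nat :=
  match b with
  | ILt e1 e2 => (icost e1 + icost e2).+1
  | RLt e1 e2 => (rcost e1 + rcost e2).+1
  | TNot b1 => (tcost b1).+1
  | TAnd b1 b2 => (tcost b1 + tcost b2).+1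
  end.

Definition upd1 A (f : nat -> A) (i : nat) (x : A) : nat -> A :=
  fun j => if j == i then x else f j.

Definition upd2 A (f : nat -> nat -> A) (a i : nat) (x : A) : nat -> nat -> A :=
  upd1 f a (upd1 (f a) i x).

(* [load f n h] agrees with h on the cells below n and with f elsewhere. *)
Definition load A (f : nat -> A) n (h : 'I_n -> A) : nat -> A :=
  fun j => if insub j is Some i then h i else f j.

Context (col : forall t, ('I_t -> V) -> {ffun 'I_t -> bool}) (T : nat -> nat).

(* [exec c s s' tau]: started in s, the program c halts in s' after tau steps.
   The relation is functional in (c, s). *)
Inductive exec : cmd -> state -> state -> nat -> Prop :=
| ExecSkip s : exec Skip s s 1
| ExecSetI r e s :
    exec (SetI r e) s (State (upd1 (ireg s) r (ieval s e)) (rmem s) (vmem s))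
      (icost e).+1
| ExecSetR a i e s :
    exec (SetR a i e) s
      (State (ireg s) (upd2 (rmem s) a (ieval s i) (reval s e)) (vmem s))
      (icost i + rcost e).+1
| ExecSetV a i e s :
    exec (SetV a i e) s
      (State (ireg s) (rmem s) (upd2 (vmem s) a (ieval s i) (veval s e)))
      (icost i + vcost e + m).+1
| ExecColor a e x s :
    let t := ieval s e in
    let eps := col (fun i : 'I_t => vmem s a i) in
    exec (Color a e x) s
      (State (ireg s)
         (upd1 (rmem s) x
            (load (rmem s x) (fun i : 'I_t => (-1) ^+ eps i : R)))
         (vmem s))
      (icost e + T t).+1
| ExecSeq c1 c2 s1 s2 s3 t1 t2 :
    exec c1 s1 s2 t1 -> exec c2 s2 s3 t2 -> exec (Seq c1 c2) s1 s3 (t1 + t2)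
| ExecIf b c1 c2 s s' t :
    exec (if teval s b then c1 else c2) s s' t ->
    exec (If b c1 c2) s s' (tcost b + t).+1
| ExecWhileEnd b c s :
    ~~ teval s b -> exec (While b c) s s (tcost b).+1
| ExecWhileStep b c s1 s2 s3 t1 t2 :
    teval s1 b -> exec c s1 s2 t1 -> exec (While b c) s2 s3 t2 ->
    exec (While b c) s1 s3 (tcost b + t1 + t2).+1.

(* Input: m and n in index registers 0 and 1, k in cell 0 of real array 0, the
   coefficients in real array 1, the points in vector array 0; 0 elsewhere. *)
Definition input_state (k n : nat) (u : 'I_n -> V) (lam : 'I_n -> R) : state :=
  State (upd1 (upd1 (fun=> 0%N) 0 m) 1 n)
    (upd1 (upd2 (fun _ _ => 0) 0 0 k%:R) 1 (load (fun=> 0) lam))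
    (upd1 (fun _ _ => 0) 0 (load (fun=> 0) u)).

(* Output: the selection u_(j 0), ..., u_(j (k-1)), reported by multiplicities:
   cell i of real array 2 holds the number of occurrences of u_i. Listing the
   k vectors would by itself take time k, which is unbounded in m. *)
Definition outputs (s : state) (k n : nat) (j : 'I_k -> 'I_n) : Prop :=
  forall i : 'I_n, rmem s 2 i = #|[pred l | j l == i]|%:R.

End Machine.

(* Main.v *)
(* Let p = 2^L >= n. The weights k p lam_i are rounded to naturals W_i of total
   k p, each with error less than 1; this costs at most (n / (k p)) vb_1, hence at
   most vb_1 / k. Then, for l = L, ..., 1, the weights of total k 2^l are halved.
   Their odd entries are even in number; they are grouped in pairs {i, i'}, and
   the vectors (u_i - u_i') / 2, which lie in P, are colored. For a sign +1 the
   entry W_i is rounded up and W_i' down, and conversely for -1, so that the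
   total is exactly halved and the error is 2 / (k 2^l) vb_t, where the number t
   of pairs is at most k 2^l. At the end the W_i are multiplicities of total k.
   As vb is monotone, the level errors sum to at most twice the series, and the
   initial error is at most twice its first term. With L the least possible, there
   are O(log m) levels, each with one coloring of at most n <= m + 1 vectors and
   O(m n) further steps. *)
Require Import Defs.
From mathcomp Require Import ring lra zify.

Set Implicit Arguments.
Unset Strict Implicit.
Unset Printing Implicit Defensive.

Import Order.TTheory GRing.Theory Num.Theory.
Local Open Scope classical_set_scope.
Local Open Scope ring_scope.

(** * The norm of a symmetric convex body *)

Section ConvexBodies.
Context {R : realType} {m : nat}.
Implicit Types (K P Q : set 'rV[R]_m) (x y : 'rV[R]_m).

Lemma body_convex K x y (a : R) : symmetric_convex_body K ->
  0 <= a <= 1 -> K x -> K y -> K (a *: x + (1 - a) *: y).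
Proof.
move=> [_ cK _ _] /andP[a0 a1] Kx Ky.
have /(_ (Itv01 a0 a1)) := cK x y.
by rewrite !inE => /(_ Kx Ky).
Qed.

Lemma bodyN K x : symmetric_convex_body K -> K x -> K (- x).
Proof. by move=> [_ _ _ KN] Kx; rewrite KN; exists x. Qed.

Lemma body_half_sub K x y : symmetric_convex_body K ->
  K x -> K y -> K (2^-1 *: (x - y)).
Proof.
move=> bK Kx Ky; have -> : 2^-1 *: (x - y) = 2^-1 *: x + (1 - 2^-1) *: - y.
  by rewrite scalerBr -scalerN; congr (_ + _ *: _); field.
by apply: body_convex => //; [lra|exact: bodyN].
Qed.

Lemma body0 K : symmetric_convex_body K -> K 0.
Proof.
move=> bK; have [_ _ [x /interior_subset Kx] _] := bK.
by have := body_half_sub bK Kx Kx; rewrite subrr scaler0.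
Qed.

(** If [K] contains the ball of radius [r] about [c], then for [|y| < r] half the difference of
    [c + y] and [c] lies in [K]; so [K] contains a ball about 0. *)
Lemma body_absorbing K x : symmetric_convex_body K ->
  exists2 s, 0 < s & K (s^-1 *: x).
Proof.
move=> bK; have [_ _ [c cK] _] := bK.
have /nbhs_normP[r /= r0 rK] : nbhs c K by exact: cK.
have Kc : K c by exact: interior_subset.
have [x1 s0] : 0 < `|x| + 1 /\ 0 < 2 / r * (`|x| + 1).
  have x1 : 0 < `|x| + 1 by rewrite ltr_wpDl.
  by split=> //; rewrite mulr_gt0// divr_gt0.
exists (2 / r * (`|x| + 1)) => //.
pose y := (r / (`|x| + 1)) *: x.
have -> : (2 / r * (`|x| + 1))^-1 *: x = 2^-1 *: ((c + y) - c).
  rewrite [c + y]addrC addrK scalerA; congr (_ *: _); field.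
  by rewrite !gt_eqF.
apply: body_half_sub => //; apply: rK => /=.
rewrite opprD addrA subrr add0r normrN normrZ gtr0_norm ?divr_gt0//.
by rewrite mulrAC -mulrA gtr_pMr// ltr_pdivrMr// mul1r ltrDl.
Qed.

Local Notation scales K x := [set s : R | 0 <= s /\ [set s *: y | y in K] x].

Lemma body_norm_le K x s : 0 <= s -> [set s *: y | y in K] x ->
  body_norm K x <= s.
Proof.
move=> s0 Kx; apply: ge_inf; last by split.
by exists 0 => ? [].
Qed.

Lemma scales_nonempty K x : symmetric_convex_body K -> scales K x !=set0.
Proof.
move=> bK; have [s s0 Ks] := body_absorbing x bK.
exists s; split; first exact: ltW.
by exists (s^-1 *: x) => //; rewrite scalerA divff ?gt_eqF// scale1r.
Qed.

Lemma body_norm_ge0 K x : symmetric_convex_body K -> 0 <= body_norm K x.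
Proof.
move=> bK; apply: lb_le_inf; first exact: scales_nonempty.
by move=> s [].
Qed.

Lemma body_norm0 K : symmetric_convex_body K -> body_norm K 0 = 0.
Proof.
move=> bK; apply/le_anti; rewrite body_norm_ge0// andbT.
by apply: body_norm_le => //; exists 0; rewrite ?scaler0//; exact: body0.
Qed.

(** If [x = s p] and [y = t q] with [p], [q] in [K], then [x + y] is [s + t] times a convex
    combination of [p] and [q]. *)
Lemma body_normD K x y : symmetric_convex_body K ->
  body_norm K (x + y) <= body_norm K x + body_norm K y.
Proof.
move=> bK; rewrite -lerBlDr; apply: lb_le_inf; first exact: scales_nonempty.
move=> s [s0 [p Kp sx]]; rewrite lerBlDl -lerBlDr.
apply: lb_le_inf; first exact: scales_nonempty.
move=> t [t0 [q Kq ty]]; rewrite lerBlDr [t + s]addrC.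
apply: body_norm_le; first exact: addr_ge0.
have [st0|st0] := eqVneq (s + t) 0.
  have [s_eq0 t_eq0] : s = 0 /\ t = 0 by split; lra.
  exists 0; first exact: body0.
  by rewrite -sx -ty s_eq0 t_eq0 !scale0r !addr0 scaler0.
exists ((s / (s + t)) *: p + (1 - s / (s + t)) *: q).
  apply: body_convex => //; have st : 0 < s + t by rewrite lt_def st0 addr_ge0.
  by rewrite divr_ge0 ?(ltW st)//= ler_pdivrMr// mul1r lerDl.
rewrite scalerDr !scalerA -sx -ty; congr (_ *: _ + _ *: _); by field.
Qed.

Lemma body_normZ_le K x c : symmetric_convex_body K ->
  body_norm K (c *: x) <= `|c| * body_norm K x.
Proof.
move=> bK; have [->|c0] := eqVneq c 0.
  by rewrite scale0r body_norm0// normr0 mul0r.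
have c_gt0 : 0 < `|c| by rewrite normr_gt0.
rewrite -ler_pdivrMl//; apply: lb_le_inf; first exact: scales_nonempty.
move=> s [s0 [p Kp sx]]; rewrite ler_pdivrMl//.
apply: body_norm_le; first by rewrite mulr_ge0.
have [c_ge0|c_lt0] := leP 0 c.
  by exists p => //; rewrite ger0_norm// -sx scalerA.
exists (- p); first exact: bodyN.
by rewrite ltr0_norm// -sx scalerA mulNr scalerN scaleNr opprK.
Qed.

Lemma body_normN K x : symmetric_convex_body K ->
  body_norm K (- x) = body_norm K x.
Proof.
move=> bK; apply/le_anti/andP; split.
  by rewrite -scaleN1r (le_trans (body_normZ_le _ _ bK))// normrN1 mul1r.
rewrite -{1}[x]opprK -(scaleN1r (- x)) (le_trans (body_normZ_le _ _ bK))//.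
by rewrite normrN1 mul1r.
Qed.

Lemma body_norm_sum K n (f : 'I_n -> 'rV[R]_m) : symmetric_convex_body K ->
  body_norm K (\sum_i f i) <= \sum_i body_norm K (f i).
Proof.
move=> bK; elim/big_ind2 : _ => //; first by rewrite body_norm0.
move=> x a y b xa yb; apply: le_trans (body_normD _ _ bK) _; exact: lerD.
Qed.

(** * Properties of the balancing numbers [vb] *)

Section Balancing.
Context (P Q : set 'rV[R]_m).
Hypotheses (bP : symmetric_convex_body P) (bQ : symmetric_convex_body Q).

Lemma vb_ge0 n : (0 <= vb n P Q)%E.
Proof.
apply: (@le_trans _ _ (\big[Order.min/+oo%E]_(x : {ffun 'I_n -> bool})
    (body_norm Q (signed_sum (fun=> 0) x))%:E)).
  by apply: le_bigmin => // x _; rewrite lee_fin body_norm_ge0.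
by apply: ereal_sup_ubound; exists (fun=> 0); split=> // _; exact: body0.
Qed.

(* Vectors are padded with 0, which lies in P. *)
Lemma vb_monotone n n' : (n <= n')%N -> (vb n P Q <= vb n' P Q)%E.
Proof.
move=> /subnKC <-; set d := (n' - n)%N.
apply: ge_ereal_sup => _ [v [Pv ->]].
pose v' (i : 'I_(n + d)) := match fintype.split i with inl j => v j | inr _ => 0 end.
have v'l i : v' (lshift d i) = v i by rewrite /v' (unsplitK (inl i)).
have v'r i : v' (rshift n i) = 0 by rewrite /v' (unsplitK (inr i)).
apply: (@le_trans _ _ (\big[Order.min/+oo%E]_(x : {ffun 'I_(n + d) -> bool})
    (body_norm Q (signed_sum v' x))%:E)).
  apply: le_bigmin; first exact: leey.
  move=> x _; apply: (@bigmin_inf _ _ _ _ [ffun i => x (lshift d i)]) => //.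
  rewrite lee_fin /signed_sum big_split_ord/= [X in _ + X]big1 ?addr0.
    by rewrite le_eqVlt; apply/orP; left; apply/eqP; congr body_norm;
      apply: eq_bigr => i _; rewrite v'l ffunE.
  by move=> i _; rewrite v'r scaler0.
apply: ereal_sup_ubound; exists v'; split=> // i; rewrite /v'.
by case: fintype.split => // _; exact: body0.
Qed.

(** The minimum runs over a finite set, nonempty because of the constant coloring, so it is attained
    and is not the default [+oo]. *)
Lemma optimal_coloring n (v : 'I_n -> 'rV[R]_m) : (forall i, P (v i)) ->
  {x : {ffun 'I_n -> bool} | ((body_norm Q (signed_sum v x))%:E <= vb n P Q)%E}.
Proof.
move=> Pv; pose F (x : {ffun 'I_n -> bool}) := (body_norm Q (signed_sum v x))%:E.
have [x _ xmin] := @eq_bigmin _ _ _ +oo%E [ffun=> false] predT F isT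
  (fun i _ => leey _).
by exists x; rewrite -[leLHS]xmin; apply: ereal_sup_ubound; exists v.
Qed.

(** A single vector has the same norm under either sign. *)
Lemma body_norm_le_vb1 x : P x -> ((body_norm Q x)%:E <= vb 1 P Q)%E.
Proof.
move=> Px; have [e] := @optimal_coloring 1 (fun=> x) (fun=> Px).
apply: le_trans; rewrite lee_fin /signed_sum big_ord1.
by case: (e ord0); rewrite ?expr0 ?expr1 ?scale1r ?scaleN1r ?body_normN.
Qed.

End Balancing.
End ConvexBodies.

(** * Pairing the odd weights *)

Lemma load_ord A (f : nat -> A) n (h : 'I_n -> A) (i : 'I_n) : load f h i = h i.
Proof. by rewrite /load valK. Qed.

Lemma exists_selection (w : nat -> nat) n k : (\sum_(i < n) w i)%N = k ->
  exists j : 'I_k -> 'I_n, forall i : 'I_n, #|[pred l | j l == i]| = w i.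
Proof.
(* Each index [i] is listed [w i] times; the list has length [k], and [j] reads it off. *)
move=> wk; pose s := flatten [seq nseq (w i) i | i : 'I_n <- enum 'I_n].
have sk : size s == k.
  rewrite size_flatten /shape -map_comp sumnE big_map -wk big_enum/=.
  by apply/eqP; apply: eq_bigr => i _; rewrite size_nseq.
exists (tnth (Tuple sk)) => i.
have -> : w i = count_mem i (Tuple sk).
  rewrite /= /s count_flatten -map_comp sumnE big_map big_enum/= (bigD1 i)//=.
  rewrite count_nseq /= eqxx mul1n big1 ?addn0// => j ji.
  by rewrite count_nseq /= (negPf ji).
rewrite -sum1_card -sum1_count big_tuple.
by apply: eq_bigl => l; rewrite inE.
Qed.

(* The odd entries of [w], in increasing order of index, are grouped in
   consecutive pairs; index [j] lies in pair number [(nodd w j)./2], as its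
   first or second member according to the parity of [nodd w j]. *)
Definition nodd (w : nat -> nat) (i : nat) : nat := \sum_(j < i) odd (w j).

Lemma noddS w i : nodd w i.+1 = (nodd w i + odd (w i))%N.
Proof. by rewrite /nodd big_ord_recr. Qed.

Lemma leq_nodd w i j : (i <= j)%N -> (nodd w i <= nodd w j)%N.
Proof.
move=> /subnKC <-; elim: (j - i)%N => [|d IH]; first by rewrite addn0.
by rewrite addnS noddS (leq_trans IH)// leq_addr.
Qed.

Lemma nodd_lt w i j : (i < j)%N -> odd (w i) -> (nodd w i < nodd w j)%N.
Proof. by move=> ij wi; have := leq_nodd w ij; rewrite noddS wi addn1. Qed.

Lemma odd_nodd w n : odd (nodd w n) = odd (\sum_(i < n) w i)%N.
Proof.
elim: n => [|n IH]; first by rewrite /nodd !big_ord0.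
by rewrite noddS big_ord_recr/= !oddD IH oddb.
Qed.

(** [true] stands for a minus sign: the first member of a pair takes the sign of the pair, the
    second member the opposite one. *)
Definition sgn_at (w : nat -> nat) (b : nat -> bool) (j : nat) : bool :=
  odd (nodd w j) (+) b (nodd w j)./2.

Definition halve (w : nat -> nat) (b : nat -> bool) (j : nat) : nat :=
  (w j)./2 + (odd (w j) && ~~ sgn_at w b j).

Section Pairing.
Context {R : realType}.
Implicit Types (w : nat -> nat) (b : nat -> bool).

Lemma halveE w b j :
  2 * (halve w b j)%:R = (w j)%:R + (odd (w j))%:R * (-1) ^+ sgn_at w b j :> R.
Proof.
rewrite /halve natrD -[X in _ = X%:R + _](odd_double_half (w j)) natrD.
rewrite -muln2 natrM.
by case: (odd (w j)) (sgn_at w b j) => -[] /=; rewrite ?expr0 ?expr1; ring.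
Qed.

(** The two signs within a complete pair cancel; only the first member of an unfinished pair can be
    left over. *)
Lemma sum_signs w b i :
  \sum_(j < i) (odd (w j))%:R * (-1) ^+ sgn_at w b j =
  (odd (nodd w i))%:R * (-1) ^+ b (nodd w i)./2 :> R.
Proof.
elim: i => [|i IH]; first by rewrite /nodd !big_ord0 mul0r.
rewrite big_ord_recr/= IH noddS /sgn_at.
have [wi|wi] := boolP (odd (w i)); last by rewrite mul0r addn0 addr0.
rewrite addn1 /= uphalf_half; have [ci|ci] := boolP (odd (nodd w i)) => /=.
  by case: (b _); rewrite ?expr0 ?expr1; ring.
by rewrite add0n mul0r add0r.
Qed.

Lemma sum_halve w b n k : (\sum_(i < n) w i)%N = k.*2 ->
  (\sum_(i < n) halve w b i)%N = k.
Proof.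
move=> wk; have /eqP := @sum_signs w b n.
rewrite odd_nodd wk odd_double mul0r => /eqP s0.
apply/eqP; rewrite -(eqr_nat R); apply/eqP/(@mulfI _ 2) => //.
rewrite natr_sum mulr_sumr; under eq_bigr do rewrite halveE.
by rewrite big_split/= s0 addr0 -natr_sum wk -muln2 natrM mulrC.
Qed.

Context {V : lmodType R}.
Implicit Types u : nat -> V.

(* [pair_vec w u i t] is what the indices below [i] contribute to half the
   difference of the two vectors of pair number [t]. *)
Definition pair_vec w u i t : V :=
  \sum_(j < i | odd (w j) && ((nodd w j)./2 == t))
    ((-1) ^+ odd (nodd w j) / 2) *: u j.

Lemma pair_vecS w u i t : pair_vec w u i.+1 t =
  pair_vec w u i t + (if odd (w i) && ((nodd w i)./2 == t)
    then ((-1) ^+ odd (nodd w i) / 2) *: u i else 0).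
Proof. by rewrite /pair_vec big_mkcond big_ord_recr/= -big_mkcond. Qed.

(** This and the next two lemmas follow pair [t] along the scan: not yet begun, only its first
    member met, complete. *)
Lemma pair_vec0 w u i t : (nodd w i <= t.*2)%N -> pair_vec w u i t = 0.
Proof.
move=> ct; apply: big1 => j /andP[wj /eqP jt].
have := nodd_lt (ltn_ord j) wj; lia.
Qed.

Lemma pair_vec1 w u i t : nodd w i = t.*2.+1 ->
  exists2 j, (j < i)%N & pair_vec w u i t = 2^-1 *: u j.
Proof.
elim: i => [|i IH]; first by rewrite /nodd big_ord0.
rewrite noddS pair_vecS; have [wi|wi] := boolP (odd (w i)) => /=; last first.
  by rewrite addn0 addr0 => /IH[j ji ->]; exists j => //; exact: ltnW.
rewrite addn1 => -[ct]; exists i => //.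
by rewrite pair_vec0 ?ct// doubleK eqxx odd_double expr0 add0r mul1r.
Qed.

Lemma pair_vec2 w u i t : (t.*2.+1 < nodd w i)%N ->
  exists j j', [/\ (j < i)%N, (j' < i)%N &
    pair_vec w u i t = 2^-1 *: (u j - u j')].
Proof.
elim: i => [|i IH]; first by rewrite /nodd big_ord0.
rewrite noddS pair_vecS.
have [ct _|ct] := ltnP t.*2.+1 (nodd w i).
  have [j [j' [ji j'i ->]]] := IH ct; exists j, j'; split; try exact: ltnW.
  by case: eqP => [?|_]; [exfalso; lia|rewrite andbF addr0].
have [wi|wi] := boolP (odd (w i)) => /=; last by rewrite addn0; lia.
rewrite addn1 ltnS => tc; have {tc}ct : nodd w i = t.*2.+1 by lia.
have [j ji ->] := pair_vec1 u ct; exists j, i; split=> //; first exact: ltnW.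
by rewrite ct/= uphalf_double eqxx odd_double expr1 mulN1r scaleNr scalerBr.
Qed.

(** After exchanging the sums, each odd index lies in exactly one pair, whose number is in range
    because [nodd w n] is even. *)
Lemma sum_pair_vec w u b n : ~~ odd (nodd w n) ->
  2 *: (\sum_(t < (nodd w n)./2) (-1) ^+ b t *: pair_vec w u n t) =
  \sum_(j < n) ((odd (w j))%:R * (-1) ^+ sgn_at w b j) *: u j.
Proof.
move=> en; rewrite scaler_sumr.
under eq_bigr => t _ do rewrite scalerA /pair_vec scaler_sumr.
rewrite (exchange_big_dep (fun j : 'I_n => odd (w j)))/=; last by move=> t j _ /andP[].
rewrite [RHS](bigID (fun j : 'I_n => odd (w j)))/=.
rewrite [X in _ = _ + X]big1 ?addr0; last first.
  by move=> j /negPf ->; rewrite mul0r scale0r.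
apply: eq_bigr => j wj.
have jT : ((nodd w j)./2 < (nodd w n)./2)%N.
  have := nodd_lt (ltn_ord j) wj.
  by have := odd_double_half (nodd w n); rewrite (negPf en); lia.
rewrite (big_pred1 (Ordinal jT)); last by move=> t /=; rewrite wj eq_sym.
rewrite scalerA; congr (_ *: _); rewrite wj /sgn_at /= signr_addb; by field.
Qed.

End Pairing.

(** * Rounding by repeated halving *)

Section Rounding.
Context {R : realType} {m : nat} (P Q : set 'rV[R]_m).
Hypotheses (bP : symmetric_convex_body P) (bQ : symmetric_convex_body Q).
Context (n k : nat) (u : nat -> 'rV[R]_m) (lam : nat -> R).
Hypotheses (k_gt0 : (0 < k)%N) (Pu : forall i, (i < n)%N -> P (u i)).
Hypotheses (lam_ge0 : forall i, 0 <= lam i) (lam_sum1 : \sum_(i < n) lam i = 1).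

Let z := \sum_(i < n) lam i *: u i.

Lemma pair_vec_body w t : (t < (nodd w n)./2)%N -> P (pair_vec w u n t).
Proof.
move=> tT; have [|j [j' [jn j'n ->]]] := @pair_vec2 _ _ w u n t.
  by clear -tT; lia.
by apply: body_half_sub => //; exact: Pu.
Qed.

(** This leaves open where the signs come from: an optimal coloring in the existence proof, the
    given procedure in the program. *)
Definition pair_coloring w (b : nat -> bool) : Prop :=
  ((body_norm Q (\sum_(t < (nodd w n)./2) (-1) ^+ b t *: pair_vec w u n t))%:E
     <= vb (nodd w n)./2 P Q)%E.

Lemma pair_coloring_empty w b : (nodd w n)./2 = 0%N -> pair_coloring w b.
Proof. by move=> T0; rewrite /pair_coloring T0 big_ord0 body_norm0// vb_ge0. Qed.

Lemma exists_pair_coloring w : exists b, pair_coloring w b.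
Proof.
have [x xP] := @optimal_coloring _ _ P Q _
  (fun t : 'I_(nodd w n)./2 => pair_vec w u n t) (fun t => pair_vec_body (ltn_ord t)).
exists (load (fun=> false) x); rewrite /pair_coloring.
by under eq_bigr do rewrite load_ord.
Qed.

(* [w] has weights in units of 1/(k 2^l), and levels l+1, ..., L have been
   processed; the error of the initial rounding is at most vb_1 / k. *)
Definition rounded_to (L l : nat) (w : nat -> nat) : Prop :=
  (\sum_(i < n) w i)%N = (k * 2 ^ l)%N /\
  ((body_norm Q (z - (k * 2 ^ l)%N%:R^-1 *: \sum_(i < n) (w i)%:R *: u i))%:E
    <= (k%:R^-1)%:E * vb 1 P Q + \sum_(l <= i < L)
         (2 * (k * 2 ^ i.+1)%N%:R^-1)%:E * vb (k * 2 ^ i.+1) P Q)%E.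

(** By [sum_pair_vec], halving changes the error vector by [- 2 / (k 2^(l+1))] times the signed sum
    of the pair vectors; its norm is paid for by the new summand at index [l]. *)
Lemma rounded_to_halve L l w b : (l < L)%N -> rounded_to L l.+1 w ->
  pair_coloring w b -> rounded_to L l (halve w b).
Proof.
move=> lL [wk wz] bw.
have wk2 : (\sum_(i < n) w i)%N = (k * 2 ^ l).*2.
  by rewrite wk expnS -muln2 -mulnA [(2 * _)%N]mulnC.
split; first exact: (@sum_halve R).
set c := (k * 2 ^ l)%N in wk wk2 *; set c' := (k * 2 ^ l.+1)%N in wk wz *.
have cE : c'%:R = 2 * c%:R :> R by rewrite -natrM; congr _%:R; rewrite /c /c' expnS; lia.
have c_gt0 : 0 < c%:R :> R by rewrite ltr0n muln_gt0 k_gt0 expn_gt0.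
have cV : 0 <= 2 * c'%:R^-1 :> R by rewrite mulr_ge0// invr_ge0.
have step : z - c%:R^-1 *: \sum_(i < n) (halve w b i)%:R *: u i =
  (z - c'%:R^-1 *: \sum_(i < n) (w i)%:R *: u i) +
  (- (2 * c'%:R^-1)) *:
    \sum_(t < (nodd w n)./2) (-1) ^+ b t *: pair_vec w u n t.
  rewrite -addrA; congr (_ + _).
  have -> : \sum_(i < n) (halve w b i)%:R *: u i = 2^-1 *:
      (\sum_(i < n) (w i)%:R *: u i +
       2 *: \sum_(t < (nodd w n)./2) (-1) ^+ b t *: pair_vec w u n t).
    rewrite sum_pair_vec ?odd_nodd ?wk2 ?odd_double// -big_split/= scaler_sumr.
    apply: eq_bigr => i _; rewrite -scalerDl -halveE scalerA.
    by congr (_ *: _); field.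
  rewrite -[- (c%:R^-1 *: _)]scaleNr -[- (c'%:R^-1 *: _)]scaleNr !scalerDr.
  by rewrite !scalerA cE; congr (_ *: _ + _ *: _); field; rewrite gt_eqF.
rewrite step big_ltn// addeCA.
apply: (@le_trans _ _ (_ + _)%:E); first by rewrite lee_fin; exact: body_normD.
rewrite EFinD addeC leeD// -?(addeC _ (_ * vb 1 _ _)%E)//.
apply: (@le_trans _ _ ((2 * c'%:R^-1)%:E * vb (nodd w n)./2 P Q)%E).
  apply: (@le_trans _ _ ((2 * c'%:R^-1)%:E * (body_norm Q (\sum_(t < (nodd w n)./2)
    (-1) ^+ b t *: pair_vec w u n t))%:E)%E).
    rewrite -EFinM lee_fin (le_trans (body_normZ_le _ _ bQ))//.
    by rewrite normrN ger0_norm.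
  by rewrite lee_wpmul2l// lee_fin.
rewrite lee_wpmul2l ?lee_fin//; apply: vb_monotone => //.
(* Every odd weight is at least 1, so the total [c'] bounds the number of odd weights. *)
have : (nodd w n <= c')%N; last by lia.
by rewrite -wk leq_sum// => i _; case: (w i) => // x; case: odd.
Qed.

(* Rounding the partial sums, instead of the coefficients, keeps the total. *)
Definition round_scaled (p i : nat) : nat :=
  Num.truncn (k%:R * p%:R * \sum_(j < i.+1) lam j) -
  Num.truncn (k%:R * p%:R * \sum_(j < i) lam j).

Lemma sum_lam_homo : {homo (fun i => \sum_(j < i) lam j) : i j / (i <= j)%N >-> i <= j}.
Proof.
by apply: homo_leq => // [x y z' |i]; [exact: le_trans|rewrite big_ord_recr/= lerDl].
Qed.

(** Prefix sums are nonnegative, so floor and truncation agree, and monotone, so the natural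
    subtraction is exact. The program computes the right-hand side. *)
Lemma round_scaledE p i : (round_scaled p i)%:R =
  (Num.floor (k%:R * p%:R * \sum_(j < i.+1) lam j))%:~R -
  (Num.floor (k%:R * p%:R * \sum_(j < i) lam j))%:~R :> R.
Proof.
have kp0 j : 0 <= k%:R * p%:R * \sum_(l < j) lam l by rewrite !mulr_ge0// sumr_ge0.
have fE (x : R) : 0 <= x -> (Num.floor x)%:~R = (Num.truncn x)%:R :> R.
  move=> x0; have fx : (0 <= Num.floor x)%R by rewrite floor_ge0.
  by rewrite truncn_floor x0 pmulrn (gez0_abs fx).
rewrite /round_scaled !fE// natrB//; apply: le_truncn.
by rewrite ler_wpM2l ?mulr_ge0//; exact: sum_lam_homo.
Qed.

Lemma round_scaled_approx p i : `|k%:R * p%:R * lam i - (round_scaled p i)%:R| <= 1.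
Proof.
rewrite round_scaledE.
rewrite (_ : k%:R * p%:R * lam i = k%:R * p%:R * (\sum_(j < i.+1) lam j) -
  k%:R * p%:R * (\sum_(j < i) lam j)); last by rewrite big_ord_recr/=; ring.
set x := k%:R * _ * _; set y := k%:R * _ * _.
have := (floor_le x, floor_le y, floorD1_gt x, floorD1_gt y).
rewrite !intrD => -[[[x1 y1] x2] y2].
by rewrite ler_norml; apply/andP; split; lra.
Qed.

(** The differences telescope, and the last scaled prefix sum is the natural number [k p] itself. *)
Lemma sum_round_scaled p : (\sum_(i < n) round_scaled p i)%N = (k * p)%N.
Proof.
rewrite -(big_mkord xpredT (round_scaled p)) /round_scaled.
rewrite (telescope_sumn _ _
  (f := fun i => Num.truncn (k%:R * p%:R * \sum_(j < i) lam j))).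
  by rewrite big_ord0 mulr0 truncn0 subn0 lam_sum1 mulr1 -natrM natrK.
move=> i j ij; apply: le_truncn.
by rewrite ler_wpM2l ?mulr_ge0//; exact: sum_lam_homo.
Qed.

Lemma rounded_to_init L : (n <= 2 ^ L)%N -> rounded_to L L (round_scaled (2 ^ L)).
Proof.
move=> nL; split; first exact: sum_round_scaled.
rewrite big_geq// adde0; set c := (k * 2 ^ L)%N.
have c_gt0 : 0 < c%:R :> R by rewrite ltr0n muln_gt0 k_gt0 expn_gt0.
have kR : 0 < k%:R :> R by rewrite ltr0n.
have uvb i : (i < n)%N -> ((body_norm Q (u i))%:E <= vb 1 P Q)%E.
  by move=> ilt; apply: body_norm_le_vb1 => //; exact: Pu.
(* If [vb 1 P Q] is infinite, so is the bound, as [k^-1 > 0]. *)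
case: (vb 1 P Q) (vb_ge0 bP bQ 1) uvb => [r r0 uvb| _ _|//]; last first.
  by rewrite gt0_muley ?leey// lte_fin invr_gt0.
rewrite -EFinM lee_fin.
have -> : z - c%:R^-1 *: \sum_(i < n) (round_scaled (2 ^ L) i)%:R *: u i =
  \sum_(i < n) (c%:R^-1 *
    (k%:R * (2 ^ L)%:R * lam i - (round_scaled (2 ^ L) i)%:R)) *: u i.
  rewrite scaler_sumr -sumrB; apply: eq_bigr => i _.
  rewrite scalerA -scalerBl mulrBr -natrM mulrA mulVf ?gt_eqF// mul1r//.
apply: le_trans (body_norm_sum _ bQ) _.
apply: (@le_trans _ _ (\sum_(i < n) c%:R^-1 * r)).
  apply: ler_sum => i _; apply: le_trans (body_normZ_le _ _ bQ) _.
  apply: ler_pM => //; first exact: body_norm_ge0.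
    rewrite normrM ger0_norm ?invr_ge0 ?(ltW c_gt0)//.
    rewrite ler_piMr ?invr_ge0 ?(ltW c_gt0)//.
    exact: round_scaled_approx.
  by rewrite -lee_fin uvb.
rewrite sumr_const card_ord -[leLHS]mulr_natl mulrA ler_wpM2r//.
rewrite ler_pdivrMr// natrM mulrA mulVf ?gt_eqF// mul1r ler_nat//.
Qed.

Lemma rounded_to_final L w : rounded_to L 0 w ->
  ((body_norm Q (z - k%:R^-1 *: \sum_(i < n) (w i)%:R *: u i))%:E
     <= ac_bound k P Q)%E.
Proof.
case=> _; rewrite expn0 muln1 => /le_trans; apply.
pose a l := (((k * 2 ^ l)%N%:R^-1)%:E * vb (k * 2 ^ l)%N P Q)%E.
have a_ge0 l : (0 <= a l)%E by rewrite mule_ge0 ?vb_ge0// lee_fin.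
have aS N : (\sum_(1 <= l < N) a l <= \sum_(1 <= l <oo) a l)%E.
  by apply: nneseries_lim_ge => l _ _.
have S_ge0 : (0 <= \sum_(1 <= l <oo) a l)%E by apply: nneseries_ge0 => l _ _.
(* Half of the factor 4 pays for the initial rounding, since [1 / k] is twice the coefficient
   [1 / (2 k)] of the first term; the other half pays for the levels. *)
rewrite /ac_bound (_ : 4%:E = 2%:E + 2%:E :> \bar R)%E; last first.
  by rewrite -EFinD; congr EFin; ring.
rewrite ge0_muleDl ?lee_fin//; apply: leeD.
  apply: (@le_trans _ _ (2%:E * a 1%N)%E).
    rewrite muleA -EFinM expn1 natrM (_ : 2 * (k%:R * 2)^-1 = k%:R^-1); last first.
      by field; rewrite pnatr_eq0 -lt0n.
    by rewrite lee_wpmul2l ?lee_fin// vb_monotone// muln_gt0 k_gt0.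
  by rewrite lee_wpmul2l ?lee_fin// (le_trans _ (aS 2%N))// big_nat1.
apply: (@le_trans _ _ (2%:E * \sum_(1 <= l < L.+1) a l)%E); last first.
  by rewrite lee_wpmul2l ?lee_fin.
rewrite ge0_sume_distrr// big_add1/=.
by apply: lee_sum => i _; rewrite EFinM muleA.
Qed.

Lemma exists_rounding L : (n <= 2 ^ L)%N -> exists w, rounded_to L 0 w.
Proof.
move=> nL; suff : forall d, (d <= L)%N -> exists w, rounded_to L (L - d) w.
  by move=> /(_ L (leqnn _)); rewrite subnn.
elim=> [_|d IH dL].
  by rewrite subn0; exists (round_scaled (2 ^ L)); exact: rounded_to_init.
have [w wP] := IH (ltnW dL); have [b bP'] := exists_pair_coloring w.
exists (halve w b); apply: rounded_to_halve => //; first by lia.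
by rewrite -subSn// subSS.
Qed.

Lemma rounding_selection L w : rounded_to L 0 w -> exists j : 'I_k -> 'I_n,
  (forall i : 'I_n, #|[pred l | j l == i]| = w i) /\
  ((body_norm Q (z - k%:R^-1 *: \sum_l u (j l)))%:E <= ac_bound k P Q)%E.
Proof.
move=> wP; have [j jw] : exists j : 'I_k -> 'I_n,
    forall i : 'I_n, #|[pred l | j l == i]| = w i.
  by apply: exists_selection; case: wP => ->; rewrite expn0 muln1.
exists j; split=> //.
rewrite (_ : \sum_l u (j l) = \sum_(i < n) (w i)%:R *: u i).
  exact: rounded_to_final wP.
(* The [k] chosen vectors are grouped by index. *)
rewrite (partition_big j predT)//=; apply: eq_bigr => i _.
by rewrite (eq_bigr (fun=> u i)) => [|l /eqP ->//]; rewrite sumr_const jw scaler_nat.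
Qed.

End Rounding.

(** * Executing programs *)

(** On these programs [run] is the exact effect and [cost] an upper bound on the time, taking the
    dearer side of a branch. The values of both at [Color] and [While] are placeholders. *)
Fixpoint straight (c : cmd) : bool :=
  match c with
  | Skip | SetI _ _ | SetR _ _ _ | SetV _ _ _ => true
  | Color _ _ _ | While _ _ => false
  | Seq c1 c2 | If _ c1 c2 => straight c1 && straight c2
  end.

Fixpoint run (R : realType) m (c : cmd) (s : state R m) : state R m :=
  match c with
  | Skip | Color _ _ _ | While _ _ => s
  | SetI r e => State (upd1 (ireg s) r (ieval s e)) (rmem s) (vmem s)
  | SetR a i e =>
      State (ireg s) (upd2 (rmem s) a (ieval s i) (reval s e)) (vmem s)
  | SetV a i e =>
      State (ireg s) (rmem s) (upd2 (vmem s) a (ieval s i) (veval s e))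
  | Seq c1 c2 => run c2 (run c1 s)
  | If b c1 c2 => if teval s b then run c1 s else run c2 s
  end.

Lemma run_if (R : realType) m b c1 c2 (s : state R m) :
  run (If b c1 c2) s = if teval s b then run c1 s else run c2 s.
Proof. by []. Qed.

Fixpoint cost (m : nat) (c : cmd) : nat :=
  match c with
  | Skip => 1
  | Color _ _ _ | While _ _ => 0
  | SetI r e => (icost e).+1
  | SetR a i e => (icost i + rcost e).+1
  | SetV a i e => (icost i + @vcost m e + m).+1
  | Seq c1 c2 => cost m c1 + cost m c2
  | If b c1 c2 => (tcost b + maxn (cost m c1) (cost m c2)).+1
  end.

Section Execution.
Context {R : realType} {m : nat}.
Context (col : forall t, ('I_t -> 'rV[R]_m) -> {ffun 'I_t -> bool}).
Context (T : nat -> nat).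
Implicit Types (s : state R m) (c : cmd) (Q : state R m -> Prop).

(** A Hoare-style judgement of total correctness with time budget [B]. *)
Definition ends c s (B : nat) Q : Prop :=
  exists s' tau, [/\ exec col T c s s' tau, (tau <= B)%N & Q s'].

Lemma ends_straight c s Q : straight c -> Q (run c s) -> ends c s (cost m c) Q.
Proof.
move=> sc Qs; exists (run c s).
suff [tau ex tauB] : exists2 tau, exec col T c s (run c s) tau & (tau <= cost m c)%N.
  by exists tau.
elim: c sc s {Qs} => //=.
- by exists 1%N => //; constructor.
- by move=> r e _ s; exists (icost e).+1 => //; constructor.
- by move=> a i e _ s; exists (icost i + rcost e).+1 => //; constructor.
- by move=> a i e _ s; exists (icost i + @vcost m e + m).+1 => //; constructor.
- move=> c1 IH1 c2 IH2 /andP[/IH1{}IH1 /IH2{}IH2] s.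
  have [t1 e1 b1] := IH1 s; have [t2 e2 b2] := IH2 (run c1 s).
  by exists (t1 + t2)%N; [apply: ExecSeq e2|rewrite leq_add].
- move=> b c1 IH1 c2 IH2 /andP[/IH1{}IH1 /IH2{}IH2] s.
  have [t e tB] : exists2 t, exec col T (if teval s b then c1 else c2) s
      (if teval s b then run c1 s else run c2 s) t &
      (t <= maxn (cost m c1) (cost m c2))%N.
    by case: teval; [have [t] := IH1 s|have [t] := IH2 s] => e tB; exists t => //;
      rewrite leq_max tB ?orbT.
  by exists (tcost b + t).+1; [constructor|rewrite ltnS leq_add2l].
Qed.

Lemma ends_weak c s B B' Q Q' : ends c s B Q -> (B <= B')%N ->
  (forall s', Q s' -> Q' s') -> ends c s B' Q'.
Proof.
move=> [s' [tau [ex tauB Qs]]] BB QQ; exists s', tau.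
by split=> //; [exact: leq_trans BB|exact: QQ].
Qed.

Lemma ends_seq c1 c2 s B1 B2 Q Q' : ends c1 s B1 Q ->
  (forall s', Q s' -> ends c2 s' B2 Q') -> ends (Seq c1 c2) s (B1 + B2) Q'.
Proof.
move=> [s1 [t1 [e1 b1 Q1]]] /(_ _ Q1)[s2 [t2 [e2 b2 Q2]]].
by exists s2, (t1 + t2)%N; split=> //; [apply: ExecSeq e2|rewrite leq_add].
Qed.

(** [Inv] is indexed by the number of rounds done; the factor [N.+1] covers [N] rounds and the
    final, failing test. *)
Lemma ends_while (Inv : nat -> state R m -> Prop) b c N B s :
  (forall i s', (i < N)%N -> Inv i s' ->
     teval s' b /\ ends c s' B (Inv i.+1)) ->
  (forall s', Inv N s' -> ~~ teval s' b) ->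
  Inv 0%N s -> ends (While b c) s ((tcost b + B).+1 * N.+1) (Inv N).
Proof.
move=> step stop I0; suff : forall d i s', (i + d = N)%N -> Inv i s' ->
    ends (While b c) s' ((tcost b + B).+1 * d.+1) (Inv N).
  by move=> /(_ N 0%N s (add0n N) I0).
elim=> [|d IH] i {I0}s dE Invi.
  rewrite addn0 in dE; rewrite dE in Invi.
  exists s, (tcost b).+1; split=> //; last by lia.
  by apply: ExecWhileEnd; exact: stop.
have iN' : (i < N)%N by lia.
have [bs [s1 [t1 [e1 b1 I1]]]] := step _ _ iN' Invi.
have [|s2 [t2 [e2 b2 I2]]] := IH i.+1 s1 _ I1; first by lia.
exists s2, (tcost b + t1 + t2).+1; split=> //.
  by apply: ExecWhileStep e1 e2.
rewrite mulnS; lia.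
Qed.

End Execution.

(** * Counting loops and doubling loops *)

Definition for_each (c : cmd) : cmd :=
  Seq (SetI 2 (INat 0))
    (While (ILt (IReg 2) (IReg 1)) (Seq c (SetI 2 (IAdd (IReg 2) (INat 1))))).

(** Register 1 holds [n], so there are [up_log 2 n] rounds, and register 5 ends at the least power
    of 2 that is at least [n]. *)
Definition doubling (c : cmd) : cmd :=
  Seq (SetI 5 (INat 1))
    (While (ILt (IReg 5) (IReg 1)) (Seq c (SetI 5 (IAdd (IReg 5) (IReg 5))))).

Section Loops.
Context {R : realType} {m : nat}.
Context (col : forall t, ('I_t -> 'rV[R]_m) -> {ffun 'I_t -> bool}).
Context (T : nat -> nat).
Context (n : nat) (Inv : nat -> state R m -> Prop) (c : cmd).

Lemma ends_for_each s : straight c ->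
  (forall i s', Inv i s' -> ireg s' 1 = n /\ ireg s' 2 = i) ->
  (forall i s', (i < n)%N -> Inv i s' ->
     Inv i.+1 (run (SetI 2 (IAdd (IReg 2) (INat 1))) (run c s'))) ->
  Inv 0%N (run (SetI 2 (INat 0)) s) ->
  ends col T (for_each c) s ((cost m c + 12) * n.+1) (Inv n).
Proof.
move=> sc Ireg step I0.
(* Besides [c], a round costs 3 for the test, 4 for the increment and 1 for the loop; initialization
   costs 2. *)
apply: (@ends_weak _ _ _ _ _ _ (2 + (cost m c + 8) * n.+1) _ (Inv n)) => //; last by lia.
apply: ends_seq (ends_straight col T (c := SetI 2 (INat 0)) isT I0) _ => s' Is.
have -> : (cost m c + 8 = (tcost (ILt (IReg 2) (IReg 1)) +
  cost m (Seq c (SetI 2 (IAdd (IReg 2) (INat 1))))).+1)%N by rewrite /=; lia.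
apply: (ends_while (Inv := Inv)) Is => [i s1 iN Ii|s1 /Ireg[r1 r2]]; last first.
  by rewrite /= r1 r2 ltnn.
have [r1 r2] := Ireg _ _ Ii; split; first by rewrite /= r1 r2.
by apply: ends_straight; [rewrite /= sc|exact: step].
Qed.

Lemma ends_doubling B s :
  (forall i s', Inv i s' -> ireg s' 1 = n /\ ireg s' 5 = (2 ^ i)%N) ->
  (forall i s', (i < up_log 2 n)%N -> Inv i s' ->
     ends col T c s' B (fun s1 =>
       Inv i.+1 (run (SetI 5 (IAdd (IReg 5) (IReg 5))) s1))) ->
  Inv 0%N (run (SetI 5 (INat 1)) s) ->
  ends col T (doubling c) s ((B + 12) * (up_log 2 n).+1) (Inv (up_log 2 n)).
Proof.
move=> Ireg step I0; set L := up_log 2 n in step *.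
apply: (@ends_weak _ _ _ _ _ _ (2 + (B + 8) * L.+1) _ (Inv L)) => //; last by lia.
apply: ends_seq (ends_straight col T (c := SetI 5 (INat 1)) isT I0) _ => s' Is.
have -> : (B + 8 = (tcost (ILt (IReg 5) (IReg 1)) +
  (B + cost m (SetI 5 (IAdd (IReg 5) (IReg 5))))).+1)%N by rewrite /=; lia.
apply: (ends_while (Inv := Inv)) Is => [i s1 iL Ii|s1 /Ireg[r1 r5]]; last first.
  by rewrite /= r1 r5 -leqNgt; exact: up_logP.
have [r1 r5] := Ireg _ _ Ii; split.
  rewrite /= r1 r5 ltnNge; apply/negP => /(up_log_min (isT : (1 < 2)%N)).
  by rewrite leqNgt iL.
apply: ends_seq (step _ _ iL Ii) _ => s2 I2.
exact: ends_straight.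
Qed.

End Loops.

(** * The rounding program *)

(* Index register 2 is the loop counter [i]; registers 3 and 4 hold the number
   of complete pairs below [i] and the parity of [nodd w i]; register 5 runs
   through the powers of 2. The weights are in real array 2, the signs of the
   pairs in real array 3, the pair vectors in vector array 1, and cell 1 of
   real array 0 accumulates the sum of the coefficients below [i]. *)
Definition weight : rexp := RCell 2 (IReg 2).
(** Parity by real arithmetic: twice the floor of [w / 2] falls short of a natural [w] exactly when
    [w] is odd. *)
Definition odd_weight : test :=
  RLt (RMul (RNat 2) (RFloor (RDiv weight (RNat 2)))) weight.
Definition member_sign : rexp := RSub (RNat 1) (RMul (RNat 2) (RIdx (IReg 4))).
(** The pair number advances only after a second member, when register 4 is 1. *)
Definition next_member : cmd :=
  Seq (SetI 3 (IAdd (IReg 3) (IReg 4))) (SetI 4 (ISub (INat 1) (IReg 4))).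
Definition restart_pairs : cmd := Seq (SetI 3 (INat 0)) (SetI 4 (INat 0)).

(** The factor in register 4 discards stale contents of the cell at the first member of a pair and
    keeps the partial sum at the second. *)
Definition collect_pairs : cmd :=
  If odd_weight
    (Seq (SetV 1 (IReg 3)
       (VAdd (VScale (RIdx (IReg 4)) (VCell 1 (IReg 3)))
             (VScale (RDiv member_sign (RNat 2)) (VCell 0 (IReg 2)))))
       next_member)
    Skip.

Definition halve_weights : cmd :=
  If odd_weight
    (Seq (SetR 2 (IReg 2)
       (RDiv (RAdd weight (RMul member_sign (RCell 3 (IReg 3)))) (RNat 2)))
       next_member)
    (SetR 2 (IReg 2) (RDiv weight (RNat 2))).

(** The test prevents a call on zero vectors, about which [coloring_procedure] says nothing. *)
Definition color_pairs : cmd :=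
  If (ILt (INat 0) (IReg 3)) (Color 1 (IReg 3) 3) Skip.

Definition level : cmd :=
  Seq restart_pairs (Seq (for_each collect_pairs) (Seq color_pairs
    (Seq restart_pairs (for_each halve_weights)))).

Definition scaled_prefix (e : rexp) : rexp :=
  RFloor (RMul (RMul (RCell 0 (INat 0)) (RIdx (IReg 5))) e).
Definition prefix_sum : rexp := RCell 0 (INat 1).
Definition next_prefix_sum : rexp := RAdd prefix_sum (RCell 1 (IReg 2)).

Definition round_weights : cmd :=
  Seq (SetR 2 (IReg 2) (RSub (scaled_prefix next_prefix_sum) (scaled_prefix prefix_sum)))
      (SetR 0 (INat 1) next_prefix_sum).

(** The first loop only leaves the scale [2^L] in register 5 for the initial rounding; the last
    restarts that register at 1 to count [L] levels. *)
Definition rounding_program : cmd :=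
  Seq (doubling Skip) (Seq (for_each round_weights) (doubling level)).

(** * Correctness and cost of the rounding program *)

Section Correctness.
Context {R : realType} {m : nat} (P Q : set 'rV[R]_m).
Hypotheses (bP : symmetric_convex_body P) (bQ : symmetric_convex_body Q).
Context (n k : nat) (u : nat -> 'rV[R]_m) (lam : nat -> R).
Hypotheses (m_gt0 : (0 < m)%N) (k_gt0 : (0 < k)%N) (n_le : (n <= m.+1)%N).
Hypotheses (Pu : forall i, (i < n)%N -> P (u i)).
Hypotheses (lam_ge0 : forall i, 0 <= lam i) (lam_sum1 : \sum_(i < n) lam i = 1).
Context (col : forall t, ('I_t -> 'rV[R]_m) -> {ffun 'I_t -> bool}).
Context (T : nat -> nat).
Hypothesis colP : coloring_procedure P Q m.+1 col T.
Implicit Types (s : state R m) (w : nat -> nat) (b : nat -> bool).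

Let M : nat := \max_(1 <= t < m.+2) T t.

Lemma coloring_time t : (0 < t <= m.+1)%N -> (T t <= M)%N.
Proof.
by move=> t_le; apply: leq_bigmax_seq => //; rewrite mem_index_iota.
Qed.

(** Reading the input at [t = m + 1] already takes this long, so [M] absorbs the [O(m n)] steps
    spent around each coloring. *)
Lemma coloring_time_ge : (m * m.+1 <= M)%N.
Proof.
have [mT _] := colP (leqnn m.+1 : (1 <= m.+1 <= m.+1)%N).
by apply: leq_trans mT (coloring_time _); rewrite leqnn.
Qed.

Definition holds_weights w s : Prop :=
  forall i, (i < n)%N -> rmem s 2 i = (w i)%:R.

Definition level_inv p w s : Prop :=
  [/\ ireg s 1 = n, ireg s 5 = p, vmem s 0 = u & holds_weights w s].

Definition scan_inv w i s : Prop :=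
  [/\ ireg s 2 = i, ireg s 3 = (nodd w i)./2 & ireg s 4 = odd (nodd w i)].

Lemma floor_half (x : nat) : Num.floor (x%:R / 2 : R) = x./2.
Proof.
apply: floor_def; have := odd_double_half x; move: (x./2) => y <-.
rewrite -muln2 intrD natrD natrM -!pmulrn.
by case: (odd x) => /=; apply/andP; split; lra.
Qed.

Lemma teval_odd_weight w s i : ireg s 2 = i ->
  rmem s 2 i = (w i)%:R -> teval s odd_weight = odd (w i).
Proof.
move=> /= -> ->; rewrite floor_half -pmulrn -natrM ltr_nat.
by have := odd_double_half (w i); case: odd => /=; lia.
Qed.

Lemma member_signE w i :
  1 - 2 * (odd (nodd w i))%:R = (-1) ^+ odd (nodd w i) :> R.
Proof. by case: odd; rewrite ?expr0 ?expr1 /=; ring. Qed.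

(** [uphalf] includes the pair that still lacks its second member, whose cell holds a partial
    sum. *)
Definition collect_inv p w i s : Prop :=
  [/\ level_inv p w s, scan_inv w i s &
      forall t, (t < uphalf (nodd w i))%N -> vmem s 1 t = pair_vec w u i t].

Lemma collect_pairs_step p w i s : (i < n)%N -> collect_inv p w i s ->
  collect_inv p w i.+1
    (run (SetI 2 (IAdd (IReg 2) (INat 1))) (run collect_pairs s)).
Proof.
move=> ilt [[r1 r5 v0 ws] [r2 r3 r4] v1].
rewrite /collect_pairs run_if (teval_odd_weight r2 (ws _ ilt)).
have [wi|wi] := boolP (odd (w i)); last first.
  split; first by split.
    by split; rewrite /= /upd1 /= ?r2 ?addn1// noddS (negPf wi) addn0.
  move=> t; rewrite noddS (negPf wi) addn0 pair_vecS (negPf wi) addr0; exact: v1.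
split; first by split; rewrite /= /upd1 /=.
  split; rewrite /= /upd1 /= ?r2 ?r3 ?r4 ?addn1// noddS wi addn1 /=.
    by rewrite uphalf_half addnC.
  by case: odd.
move=> t; rewrite noddS wi addn1 /= => tlt.
rewrite /= /upd2 /upd1 /= r2 r3 r4 pair_vecS wi v0 member_signE /=.
have [->|tc] := eqVneq t (nodd w i)./2.
  congr (_ + _).
  have [ci|ci] := boolP (odd (nodd w i)).
    by rewrite scale1r v1// uphalf_half ci; lia.
  by rewrite scale0r pair_vec0//; lia.
by rewrite addr0 v1//; move: tc tlt; rewrite uphalf_half; lia.
Qed.

(** The weights are overwritten in place; those from [i] on are still the old ones, so their
    parities can be read. *)
Definition halve_inv p w b i s : Prop :=
  [/\ [/\ ireg s 1 = n, ireg s 5 = p & vmem s 0 = u], scan_inv w i s,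
      forall t, (t < (nodd w n)./2)%N -> rmem s 3 t = (-1) ^+ b t &
      forall j, (j < n)%N -> rmem s 2 j = (if (j < i)%N then halve w b j else w j)%:R].

Lemma halve_weights_step p w b i s : ~~ odd (nodd w n) -> (i < n)%N ->
  halve_inv p w b i s ->
  halve_inv p w b i.+1
    (run (SetI 2 (IAdd (IReg 2) (INat 1))) (run halve_weights s)).
Proof.
move=> en ilt [[r1 r5 v0] [r2 r3 r4] x3 ws].
have wsi : rmem s 2 i = (w i)%:R by rewrite ws// ltnn.
have upd j x : (j < n)%N -> x = (halve w b i)%:R ->
    (if j == i then x else rmem s 2 j) =
    (if (j < i.+1)%N then halve w b j else w j)%:R.
  by move=> jn ->; rewrite ltnS leq_eqVlt; case: eqP => [->//|_]; exact: ws.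
have := halveE (R := R) w b i.
rewrite /halve_weights run_if (teval_odd_weight r2 wsi).
have [wi|wi] := boolP (odd (w i)) => hE; last first.
  split=> //; first by split; rewrite /= /upd1 /= ?r2 ?addn1// noddS (negPf wi) addn0.
  move=> j jn; rewrite /= /upd2 /upd1 /= r2; apply: upd => //.
  by move: hE; rewrite wsi mulr0n mul0r; lra.
split=> //.
  split; rewrite /= /upd1 /= ?r2 ?r3 ?r4 ?addn1// noddS wi addn1 /=.
    by rewrite uphalf_half addnC.
  by case: odd.
move=> j jn; rewrite /= /upd2 /upd1 /= r2 r3 r4; apply: upd => //.
rewrite member_signE wsi x3; last by have := nodd_lt ilt wi; lia.
by move: hE; rewrite /sgn_at signr_addb mulr1n mul1r; lra.
Qed.

Lemma ends_color_pairs p w s : ~~ odd (nodd w n) -> collect_inv p w n s ->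
  ends col T color_pairs s (M + 6) (fun s' => level_inv p w s' /\
    exists2 b, pair_coloring P Q n u w b &
      forall t, (t < (nodd w n)./2)%N -> rmem s' 3 t = (-1) ^+ b t).
Proof.
move=> en [[r1 r5 v0 ws] [_ r3 _] v1].
have [T0|T_gt0] := posnP (nodd w n)./2.
  exists s, (tcost (ILt (INat 0) (IReg 3)) + 1).+1; split; last first.
  - split=> //; exists (fun=> false); first exact: pair_coloring_empty.
    by move=> t; rewrite T0.
  - by rewrite /=; lia.
  by apply: ExecIf; rewrite /= r3 T0; constructor.
have vE (t : 'I_(ireg s 3)) : vmem s 1 t = pair_vec w u n t.
  by apply: v1; rewrite uphalf_half (negPf en) -r3.
(* At most [n <= m + 1] weights are odd, so the call is in the range covered by [colP]. *)
have T_le : (0 < ireg s 3 <= m.+1)%N.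
  have := leq_sum (index_enum 'I_n) (P := xpredT)
    (E1 := fun i => nat_of_bool (odd (w i)))
    (E2 := fun=> 1%N) (fun i _ => leq_b1 (odd (w i))).
  by rewrite sum1_card card_ord -/(nodd w n) r3; lia.
have Pv (t : 'I_(ireg s 3)) : P (vmem s 1 t).
  by rewrite vE; apply: (pair_vec_body bP Pu); rewrite -r3; exact: ltn_ord.
set eps := col (fun t : 'I_(ireg s 3) => vmem s 1 t).
exists (State (ireg s) (upd1 (rmem s) 3
    (load (rmem s 3) (fun t : 'I_(ireg s 3) => (-1) ^+ eps t : R))) (vmem s)).
exists (tcost (ILt (INat 0) (IReg 3)) + (icost (IReg 3) + T (ireg s 3)).+1).+1.
split.
  have tT : teval s (ILt (INat 0) (IReg 3)) by rewrite /= r3.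
  by apply: ExecIf; rewrite tT; exact: ExecColor.
  by have := coloring_time T_le; rewrite /=; lia.
split; first by split.
exists (load (fun=> false) eps).
  have [_ /(_ _ Pv)] := colP T_le.
  rewrite /pair_coloring -r3; apply: le_trans; rewrite lee_fin /signed_sum.
  rewrite le_eqVlt; apply/orP; left; apply/eqP; congr body_norm.
  by apply: eq_bigr => t _; rewrite load_ord vE.
rewrite -r3 => t tlt; rewrite /= /upd1 /=.
by rewrite (load_ord _ _ (Ordinal tlt)) (load_ord _ _ (Ordinal tlt)).
Qed.

Lemma ends_level p w s : ~~ odd (nodd w n) -> level_inv p w s ->
  ends col T level s
    (4 + ((cost m collect_pairs + 12) * n.+1 + (M + 6 +
      (4 + (cost m halve_weights + 12) * n.+1))))
    (fun s' => exists2 b, pair_coloring P Q n u w b & level_inv p (halve w b) s').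
Proof.
move=> en [r1 r5 v0 ws].
have w0 : nodd w 0 = 0%N by rewrite /nodd big_ord0.
apply: ends_seq.
  by apply: (@ends_straight _ _ col T restart_pairs s (eq (run restart_pairs s))).
move=> _ <-; apply: ends_seq.
  apply: (ends_for_each col T (Inv := collect_inv p w)) => //.
  - by move=> i s' [[? ? ? ?] [? ? ?] ?].
  - by move=> i s' ilt; exact: collect_pairs_step.
  - by split; [split|split|]; rewrite /= ?w0.
move=> {r1 r5 v0 ws}{}s /(ends_color_pairs en)/ends_seq; apply.
move=> {}s [[r1 r5 v0 ws] [b bP' x3]]; apply: ends_seq.
  by apply: (@ends_straight _ _ col T restart_pairs s (eq (run restart_pairs s))).
move=> _ <-; apply: ends_weak; first apply:
    (ends_for_each col T (n := n) (Inv := halve_inv p w b) (c := halve_weights)) => //.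
- by move=> i s' [[? ? ?] [? ? ?] ? ?].
- by move=> i s' ilt; exact: halve_weights_step.
- by split => //; split; rewrite /= ?w0.
- by [].
- move=> s' [[? ? ?] _ _ wn]; exists b => //; split=> // i ilt.
  by rewrite wn// ilt.
Qed.

Definition holds_input s : Prop :=
  [/\ ireg s 1 = n, rmem s 0 0 = k%:R, rmem s 1 = lam & vmem s 0 = u].

Definition round_inv p i s : Prop :=
  [/\ holds_input s, ireg s 2 = i /\ ireg s 5 = p, rmem s 0 1 = \sum_(j < i) lam j &
    forall j, (j < i)%N -> rmem s 2 j = (round_scaled k lam p j)%:R].

Lemma round_weights_step p i s : (i < n)%N -> round_inv p i s ->
  round_inv p i.+1 (run (SetI 2 (IAdd (IReg 2) (INat 1))) (run round_weights s)).
Proof.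
move=> ilt [[r1 x0 x1 v0] [r2 r5] A ws].
split=> //; first by split; rewrite /= /upd1 /= ?r2 ?addn1.
  by rewrite /= /upd2 /upd1 /= A x1 r2 big_ord_recr.
move=> j; rewrite ltnS leq_eqVlt /= /upd2 /upd1 /= r2 r5 x0 x1 A.
case: eqVneq => [-> _|_]; last exact: ws.
by rewrite round_scaledE// big_ord_recr.
Qed.

Let L := up_log 2 n.

Lemma ends_rounding_program s : holds_input s -> rmem s 0 1 = 0 ->
  ends col T rounding_program s (2000 * (L.+1 * M))
    (fun s' => exists2 w, rounded_to P Q n k u lam L 0 w & holds_weights w s').
Proof.
move=> sI s01.
pose B := (4 + ((cost m collect_pairs + 12) * n.+1 + (M + 6 +
      (4 + (cost m halve_weights + 12) * n.+1))))%N.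
apply: (@ends_weak _ _ col T _ s ((1 + 12) * L.+1 +
    ((cost m round_weights + 12) * n.+1 + (B + 12) * L.+1)) _
    (fun s' => exists2 w, rounded_to P Q n k u lam L 0 w & holds_weights w s')).
- apply: ends_seq.
    apply: (ends_doubling (col := col) (T := T) (n := n) (c := Skip) (B := 1)
      (Inv := fun j s' =>
      [/\ holds_input s', rmem s' 0 1 = 0 & ireg s' 5 = (2 ^ j)%N])) => //.
    + by move=> i s' [[? ? ? ?] ? ?].
    + move=> i s' _ [[? ? ? ?] ? r5]; apply: ends_straight => //.
      by split=> //; rewrite /= /upd1 /= r5 expnS mul2n addnn.
  move=> {sI s01}{}s [[? ? ? ?] s01 r5]; apply: ends_seq.
    apply: (ends_for_each col T (n := n) (Inv := round_inv (2 ^ L))) => //.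
    + by move=> i s' [[? ? ? ?] [? ?] _ _].
    + by move=> i s' ilt; exact: round_weights_step.
    + by split=> //; rewrite /= big_ord0.
  move=> s1 [[r1' _ _ v0'] [_ r5'] _ ws].
  apply: ends_weak; first apply: (ends_doubling (col := col) (T := T)
    (n := n) (c := level) (B := B) (Inv := fun j s' => exists2 w, rounded_to P Q n k u lam L (L - j) w &
       level_inv (2 ^ j) w s')).
  + by move=> i s' [w _ []].
  + move=> i s' iL [w wR lv].
    (* The current total [k 2^(L-i)] is even because [i < L]. *)
    have wE : ~~ odd (nodd w n).
      rewrite odd_nodd; case: wR => -> _.
      by rewrite oddM oddX subn_eq0 leqNgt iL/= andbF.
    apply: ends_weak (ends_level wE lv) (leqnn _) _.
    move=> s2 [b bw [? r5b ? ?]]; exists (halve w b).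
      apply: rounded_to_halve => //; first by lia.
      by rewrite subnSK.
    by split=> //; rewrite /= /upd1 /= r5b expnS mul2n addnn.
  + exists (round_scaled k lam (2 ^ L)); last by split.
    by rewrite subn0; apply: rounded_to_init => //; exact: up_logP.
  + by [].
  + by move=> s' [w]; rewrite subnn => wR [_ _ _ ?]; exists w.
(* From [n + 1 <= m + 2] and [m (m + 1) <= M] one gets [(n + 1) m <= 3 M]; as [m >= 1], the
   lower-order costs fit too, and 2000 is a generous constant. *)
- have := coloring_time_ge; rewrite /B /=; clearbody M; move: m_gt0 n_le => m0 nm mM.
  have nmM : (n.+1 * m <= 3 * M)%N by nia.
  nia.
- by [].
Qed.

End Correctness.

(** * The running time *)

(** With [L = up_log 2 n] the claim is [2^(L+1) <= (m+1)^3]; for [n > 1] it follows from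
    [2^(L-1) < n <= m + 1] and [4 <= (m+1)^2]. *)
Lemma up_log2_ln_le (R : realType) m n : (0 < m)%N -> (n <= m.+1)%N ->
  (up_log 2 n).+1%:R <= 3 / ln 2 * ln m.+1%:R :> R.
Proof.
move=> m0 nm; have ln2 : 0 < ln 2 :> R by rewrite ln_gt0// ltr1n.
rewrite mulrAC ler_pdivlMr// !mulr_natl -!lnXn ?ltr0n// -!natrX.
rewrite ler_ln ?posrE ?ltr0n ?expn_gt0// ler_nat.
have [n1|n1] := leqP n 1.
  have -> : up_log 2 n = 0%N by apply/eqP; rewrite up_log_eq0 n1 orbT.
  by apply: (@leq_trans (2 ^ 3)%N) => //; rewrite leq_exp2r.
have := up_log_gtn (isT : (1 < 2)%N) n1.
have : (0 < up_log 2 n)%N by rewrite up_log_gt0.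
case: (up_log 2 n) => // l _ /= ln; rewrite !expnS expn0 muln1.
have : (2 ^ l < m.+1)%N by exact: leq_trans ln nm.
move: (2 ^ l)%N => x; nia.
Qed.

Lemma running_time_le (R : realType) (K M tau m n : nat) :
  (0 < m)%N -> (n <= m.+1)%N -> (tau <= K * ((up_log 2 n).+1 * M))%N ->
  tau%:R <= K%:R * (3 / ln 2) * ln m.+1%:R * M%:R :> R.
Proof.
move=> m0 nm tauB; apply: (@le_trans _ _ (K * ((up_log 2 n).+1 * M))%N%:R).
  by rewrite ler_nat.
rewrite natrM natrM mulrA ler_wpM2r// -mulrA ler_wpM2l//.
exact: up_log2_ln_le.
Qed.

Theorem theorem2 (R : realType) :
  (forall (m k : nat) (P Q : set 'rV[R]_m),
     (0 < k)%N -> symmetric_convex_body P -> symmetric_convex_body Q ->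
     (ac k P Q <= ac_bound k P Q)%E)
  /\
  exists (prog : cmd) (C : R),
    forall (m k n : nat) (P Q X : set 'rV[R]_m)
      (u : 'I_n -> 'rV[R]_m) (lam : 'I_n -> R) (z : 'rV[R]_m),
      (0 < m)%N -> (0 < k)%N -> (n <= m.+1)%N ->
      symmetric_convex_body P -> symmetric_convex_body Q ->
      X `<=` P -> (forall i, X (u i)) ->
      (forall i, 0 <= lam i) -> \sum_i lam i = 1 ->
      z = \sum_i lam i *: u i ->
    forall (col : forall t, ('I_t -> 'rV[R]_m) -> {ffun 'I_t -> bool})
      (T : nat -> nat),
      coloring_procedure P Q m.+1 col T ->
    exists (s : state R m) (tau : nat) (j : 'I_k -> 'I_n),
      [/\ exec col T prog (input_state k u lam) s tau,
          outputs s j,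
          ((body_norm Q (z - k%:R^-1 *: \sum_l u (j l)))%:E
             <= ac_bound k P Q)%E
        & tau%:R <= C * ln m.+1%:R * (\max_(1 <= t < m.+2) T t)%N%:R].
Proof.
(* Finite families are extended by 0 to all naturals, just as [input_state] fills the memory. *)
have inputs m (P X : set 'rV[R]_m) n (u : 'I_n -> 'rV[R]_m) (lam : 'I_n -> R) z :
    X `<=` P -> (forall i, X (u i)) -> (forall i, 0 <= lam i) ->
    \sum_i lam i = 1 -> z = \sum_i lam i *: u i ->
  let u' := load (fun=> 0) u in let lam' := load (fun=> 0) lam in
  [/\ forall i, (i < n)%N -> P (u' i), forall i, 0 <= lam' i,
    \sum_(i < n) lam' i = 1 & z = \sum_(i < n) lam' i *: u' i].
  move=> XP Xu lam0 lam1 zE /=; split.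
  - by move=> i ilt; rewrite (load_ord _ _ (Ordinal ilt)); exact/XP/Xu.
  - by move=> i; rewrite /load; case: insub.
  - by under eq_bigr do rewrite load_ord.
  - by under eq_bigr do rewrite !load_ord.
have uj m n k (u : 'I_n -> 'rV[R]_m) (j : 'I_k -> 'I_n) :
    \sum_l load (fun=> 0) u (j l) = \sum_l u (j l).
  by apply: eq_bigr => l _; rewrite load_ord.
split=> [m k P Q k0 bP bQ|].
  apply: ge_ereal_sup => _ [X [z [XP [n [u [lam [Xu lam0 lam1 zE]]]] ->]]].
  have [Pu' lam'0 lam'1 zE'] := inputs _ _ _ _ _ _ _ XP Xu lam0 lam1 zE.
  have [w wR] := exists_rounding bP bQ k0 Pu' lam'0 lam'1 (up_logP n (isT : (1 < 2)%N)).
  have [j [_ jB]] := rounding_selection bP bQ k0 wR.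
  apply: le_trans jB; apply: ereal_inf_lbound; exists (u \o j); split=> [i|//].
    exact: Xu.
  by rewrite zE' -(uj _ _ _ u j).
exists rounding_program, (2000%:R * (3 / ln 2)).
move=> m k n P Q X u lam z m0 k0 nm bP bQ XP Xu lam0 lam1 zE col T colP.
have [Pu' lam'0 lam'1 zE'] := inputs _ _ _ _ _ _ _ XP Xu lam0 lam1 zE.
have [] := @ends_rounding_program _ _ _ _ bP bQ n k _ _ m0 k0 nm Pu' lam'0 lam'1
  col T colP (input_state k u lam) => //.
move=> s [tau [ex tauB [w wR ws]]].
have [j [jw jB]] := rounding_selection bP bQ k0 wR.
exists s, tau, j; split=> //.
- by move=> i; rewrite ws// jw.
- by rewrite zE' -(uj _ _ _ u j).
- exact: running_time_le tauB.
Qed.
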